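(* Let $n\geq 4$ be an integer, let $G=\mathrm{Sym}(n)$ be the symmetric group on $n$ letters, and let $Z_n$ be the set of all $n$-cycles in $G$. Let $\Gamma_n=\mathrm{Cay}(G,Z_n)$. Then $\Gamma_n$ is an integral hyperenergetic graph, its energy is $\mathcal{E}(\Gamma_n)=2^{n-1}(n-1)!$, and its nullity is $\eta(\Gamma_n)=n!-\binom{2n-2}{n-1}$.
   Context: For a finite group $G$ and an inverse-closed subset $S\subseteq G$ with $1\notin S$, the Cayley graph $\mathrm{Cay}(G,S)$ has vertex set $G$, with $u,v$ adjacent iff $v=au$ for some $a\in S$. The eigenvalues of a simple graph are the eigenvalues of its adjacency matrix. A graph is integral if all its eigenvalues are integers. The energy $\mathcal{E}(\Gamma)$ of a graph $\Gamma$ is the sum of the absolute values of its eigenvalues (with multiplicity). A simple graph $\Gamma$ on $N$ vertices is hyperenergetic if $\mathcal{E}(\Gamma)>2N-2$. The nullity $\eta(\Gamma)$ is the multiplicity of $0$ as an eigenvalue of $\Gamma$. *)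

(* Defs.v *)
From HB Require Import structures.
From mathcomp Require Import all_boot all_order all_algebra all_fingroup all_field.
Set Implicit Arguments. Unset Strict Implicit. Unset Printing Implicit Defensive.
Import Order.TTheory GRing.Theory Num.Theory.
Local Open Scope ring_scope.

Definition cayley_adj (gT : finGroupType) (S : {set gT}) : 'M[algC]_#|gT| :=
  \matrix_(i, j) ((enum_val j * (enum_val i)^-1)%g \in S)%:R.

(* Eigenvalues with multiplicity: the roots (with multiplicity) of the
   characteristic polynomial, which splits over the closed field algC. *)
Definition spectrum (N : nat) (A : 'M[algC]_N) : seq algC :=
  sval (closed_field_poly_normal (char_poly A)).

Definition integral_mx (N : nat) (A : 'M[algC]_N) : bool :=
  all (fun x => x \in Num.int) (spectrum A).

Definition energy (N : nat) (A : 'M[algC]_N) : algC :=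
  \sum_(x <- spectrum A) `|x|.

Definition nullity (N : nat) (A : 'M[algC]_N) : nat :=
  count_mem 0 (spectrum A).

Definition hyperenergetic (N : nat) (A : 'M[algC]_N) : bool :=
  energy A > 2 * N%:R - 2.

Definition ncycles (n : nat) : {set {perm 'I_n}} :=
  [set s | [exists x : 'I_n, porbit s x == [set: 'I_n]]].

(* Main.v *)
(* The eigenvalues of Cay(Sym(n), Z_n) are n! chi(c) / (n chi(1)), with
   multiplicity chi(1)^2, for chi irreducible and c an n-cycle.  Let psi_k be
   induced from the character sgn(s|_{0..k-1}) of the stabiliser of {0,...,k-1}
   (the k-th exterior power of the permutation character).  Mackey's formula
   gives <psi_k, psi_l> = 2 if k = l (1 if k = 0), 1 if |k - l| = 1 and 0
   otherwise, so chi_k = psi_k - psi_{k-1} + psi_{k-2} - ... (k < n) are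
   orthonormal, hence irreducible.  As an n-cycle stabilises no proper nonempty
   subset, chi_k(c) = (-1)^k.  The sum of |chi(c)|^2 over all irreducible chi is
   the order n of the centraliser of c, so every other irreducible character
   vanishes at c.  The nonzero eigenvalues are therefore (-1)^k k! (n-1-k)! with
   multiplicity C(n-1,k)^2. *)
Require Import Defs.
From HB Require Import structures.
From mathcomp Require Import all_boot all_order all_algebra all_fingroup all_field.
From mathcomp Require Import all_solvable all_character.
From mathcomp Require Import zify ring.
Set Implicit Arguments. Unset Strict Implicit. Unset Printing Implicit Defensive.
Import Order.TTheory GRing.Theory Num.Theory.
Local Open Scope ring_scope.

(** * Spectra of normal matrices through power sums *)

(** Equal power sums give equal sums of every polynomial. One that vanishes at all entries except
    [a] then compares the multiplicities of [a]. *)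
Lemma perm_eq_power_sums (R : numDomainType) (s t : seq R) :
    (forall m, \sum_(x <- s) x ^+ m = \sum_(x <- t) x ^+ m) -> perm_eq s t.
Proof.
move=> eq_st.
have eq_horner (p : {poly R}) : \sum_(x <- s) p.[x] = \sum_(x <- t) p.[x].
  under eq_bigr do rewrite horner_coef.
  under [RHS]eq_bigr do rewrite horner_coef.
  rewrite exchange_big [RHS]exchange_big; apply: eq_bigr => i _ /=.
  by rewrite -!mulr_sumr eq_st.
apply/allP => a _ /=; apply/eqP.
pose p := \prod_(b <- undup (s ++ t) | b != a) ('X - b%:P).
have pa : p.[a] != 0.
  rewrite horner_prod prodf_seq_neq0; apply/allP => b _; apply/implyP => neq_ba.
  by rewrite hornerXsubC subr_eq0 eq_sym.
have sum_p r : {subset r <= s ++ t} ->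
    \sum_(x <- r) p.[x] = (count_mem a r)%:R * p.[a].
  elim: r => [|x r IHr] sub_r; first by rewrite big_nil mul0r.
  rewrite big_cons /= natrD mulrDl IHr => [|y ry]; last first.
    by rewrite sub_r // inE ry orbT.
  congr (_ + _); have [-> | neq_xa] := eqVneq x a; first by rewrite mul1r.
  rewrite mul0r; apply/eqP; rewrite -[_ == 0]/(root p x).
  rewrite /p -big_filter root_prod_XsubC mem_filter neq_xa mem_undup sub_r //.
  exact: mem_head.
have := eq_horner p.
rewrite !sum_p => [/(mulIf pa)/eqP|x|x]; first by rewrite eqr_nat => /eqP.
  by rewrite mem_cat orbC => ->.
by rewrite mem_cat => ->.
Qed.

Lemma char_poly_conj (F : fieldType) n (P A : 'M[F]_n) :
  P \in unitmx -> char_poly (invmx P *m A *m P) = char_poly A.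
Proof.
move=> Pu; rewrite /char_poly.
have -> : char_poly_mx (invmx P *m A *m P)
        = map_mx polyC (invmx P) *m char_poly_mx A *m map_mx polyC P.
  rewrite /char_poly_mx mulmxBr mulmxBl -!map_mxM /=; congr (_ - _).
  rewrite mul_mx_scalar -scalemxAl -map_mxM /= mulVmx // map_mx1.
  by rewrite scalemx1.
rewrite !det_mulmx mulrAC -det_mulmx -map_mxM mulVmx //= map_mx1.
by rewrite det1 mul1r.
Qed.

(** By the spectral theorem [A] is unitarily similar to a diagonal matrix. Unique factorisation of
    the characteristic polynomial identifies its diagonal with [spectrum A], and the trace ignores
    the similarity. *)
Lemma spectrum_power_sum N (A : 'M[algC]_N) m : A \is normalmx ->
  \sum_(x <- spectrum A) x ^+ m = \tr (A ^+ m).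
Proof.
move/orthomx_spectralP; set P := spectralmx A; set d := spectral_diag A => defA.
have Pu : P \in unitmx by apply: unitarymx_unit; apply: spectral_unitarymx.
have eq_spec : perm_eq (spectrum A) [seq d 0 i | i <- enum 'I_N].
  rewrite /spectrum; case: closed_field_poly_normal => s /= ds.
  apply: prod_XsubC_eq; rewrite big_map enumT.
  have lcA : lead_coef (char_poly A) = 1 by apply/monicP/char_poly_monic.
  rewrite lcA scale1r in ds; rewrite -ds [in LHS]defA char_poly_conj //.
  rewrite char_poly_trig ?diag_mx_is_trig //.
  by apply: eq_bigr => i _; rewrite mxE eqxx mulr1n.
rewrite (perm_big _ eq_spec) big_map enumT /=.
have powA : A ^+ m = invmx P *m diag_mx d ^+ m *m P.
  elim: m => [|m IHm]; first by rewrite !expr0 mulmx1 mulVmx.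
  have -> : A ^+ m.+1 = A ^+ m *m A by exact: exprSr.
  have -> : diag_mx d ^+ m.+1 = diag_mx d ^+ m *m diag_mx d by exact: exprSr.
  by rewrite IHm [X in _ *m X]defA !mulmxA mulmxK.
rewrite powA mxtrace_mulC mulmxA mulmxV // mul1mx.
have -> : diag_mx d ^+ m = diag_mx (\row_i d 0 i ^+ m).
  elim: m {powA} => [|m IHm].
    by rewrite expr0; apply/matrixP=> i j; rewrite !mxE expr0.
  rewrite exprSr IHm -[LHS]/(_ *m _) mulmx_diag; congr diag_mx.
  by apply/rowP => i; rewrite !mxE exprSr.
by rewrite mxtrace_diag; apply: eq_bigr => i _; rewrite mxE.
Qed.

(** * Characters induced from signs of subset stabilisers *)

Section SignedInduction.
Local Open Scope group_scope.
Implicit Type T : finType.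

Lemma perm_astabsP T (A : {set T}) (s : {perm T}) :
  reflect (forall x, (s x \in A) = (x \in A)) (s \in 'N(A | 'P)).
Proof.
by apply: (iffP astabsP).
Qed.

(** Since [s] stabilises [A :\: C], which has at most one point, it fixes that point. *)
Lemma restr_permI T (A C : {set T}) (s : {perm T}) :
    s \in 'N(A | 'P) -> s \in 'N(C | 'P) -> (#|A :\: C| <= 1)%N ->
  restr_perm A s = restr_perm (A :&: C) s.
Proof.
move=> sA sC cardAC.
have sAC : s \in 'N(A :&: C | 'P).
  apply/perm_astabsP => x; rewrite !inE.
  by rewrite (perm_astabsP _ _ sA) (perm_astabsP _ _ sC).
apply/permP => x; have [Ax | A'x] := boolP (x \in A); last first.
  rewrite !(out_perm (restr_perm_on _ _)) // inE; first by rewrite negb_and A'x.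
rewrite restr_permE //; have [Cx | C'x] := boolP (x \in C).
  by rewrite restr_permE // inE Ax.
rewrite (out_perm (restr_perm_on _ _)) ?inE ?negb_and ?C'x ?orbT //.
apply: (card_le1_eqP cardAC); rewrite !inE ?C'x //.
by rewrite (perm_astabsP _ _ sA) (perm_astabsP _ _ sC) C'x.
Qed.

(** A representation of degree one, so that [cfRepr] yields a character of the stabiliser. *)
Definition sgn_mx T (A : {set T}) (s : {perm T}) : 'M[algC]_1 :=
  ((-1) ^+ restr_perm A s)%:M%R.

Lemma sgn_mx_repr T (A : {set T}) : mx_repr 'N(A | 'P) (sgn_mx A).
Proof.
split=> [|s t sA tA]; rewrite /sgn_mx; first by rewrite morph1 odd_perm1.
by rewrite morphM // odd_permM signr_addb scalar_mxM.
Qed.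

Definition sgn_on T (A : {set T}) : 'CF('N(A | 'P)) :=
  cfRepr (MxRepresentation (sgn_mx_repr A)).

Lemma sgn_onE T (A : {set T}) (s : {perm T}) :
  s \in 'N(A | 'P) -> sgn_on A s = ((-1) ^+ restr_perm A s)%R.
Proof. by move=> sA; rewrite cfunE sA mxtrace_scalar. Qed.

Lemma sgn_onM T (A : {set T}) :
  {in 'N(A | 'P) &, {morph sgn_on A : s t / s * t >-> (s * t)%R}}.
Proof.
by move=> s t sA tA; rewrite !sgn_onE ?groupM // morphM // odd_permM signr_addb.
Qed.

Lemma conj_sgn_on T (A : {set T}) (s : {perm T}) :
  ((sgn_on A s)^*)%R = sgn_on A s.
Proof.
have [sA | sA'] := boolP (s \in 'N(A | 'P)); last by rewrite cfun0 ?conjC0.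
by rewrite sgn_onE // rmorph_sign.
Qed.

Lemma mem_setact_perm T (A : {set T}) (s : {perm T}) x :
  (x \in 'P^*%act A s) = (s^-1 x \in A).
Proof. by rewrite -{1}(permKV s x); apply/mem_imset/perm_inj. Qed.

Lemma sgn_onJ T (A : {set T}) (s t : {perm T}) :
  sgn_on A (s ^ t) = sgn_on ('P^*%act A t^-1) s.
Proof.
have mem_conj : (s ^ t \in 'N(A | 'P)) = (s \in 'N('P^*%act A t^-1 | 'P)).
  apply/perm_astabsP/perm_astabsP => sA x.
    rewrite !mem_setact_perm invgK -(sA (t x)); congr (_ \in A).
    by rewrite !permM permK.
  have := sA (t^-1 x); rewrite !mem_setact_perm invgK permKV => <-.
  by rewrite !permM.
have [sA | sA'] := boolP (s ^ t \in 'N(A | 'P)); last first.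
  by rewrite !cfun0 // -mem_conj.
rewrite !sgn_onE -?mem_conj //; congr (_ ^+ nat_of_bool _)%R.
rewrite -[RHS](odd_permJ _ t); congr odd_perm; apply/permP => x.
rewrite -[x](permKV t) permJ; move: (t^-1 x) => {}x.
have memA : (x \in 'P^*%act A t^-1) = (t x \in A) by rewrite mem_setact_perm invgK.
have [Ax | A'x] := boolP (t x \in A).
  by rewrite !restr_permE -?mem_conj ?memA // permJ.
by rewrite !(out_perm (restr_perm_on _ _)) ?memA.
Qed.

(** The fibres of the orbit map are cosets of the stabiliser of [x], so all have its size. *)
Lemma sum_act_orbit (aT : finGroupType) (rT : finType) (to : {action aT &-> rT})
    (G : {group aT}) (x : rT) (F : rT -> algC) :
  (\sum_(a in G) F (to x a)
   = #|'C_G[x | to]|%:R * \sum_(y in orbit to G x) F y)%R.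
Proof.
rewrite (partition_big (fun a => to x a) [in orbit to G x]) /=;
  last by move=> a; apply: mem_orbit.
rewrite mulr_sumr; apply: eq_bigr => y /orbitP[a Ga <-].
rewrite (eq_bigr (fun _ => F (to x a))) => [|b /andP[_ /eqP->] //].
rewrite sumr_const mulr_natl -(card_rcoset _ a) -amove_act ?subsetT //.
by congr (_ *+ _)%R; apply: eq_card => b; rewrite !inE.
Qed.

Definition ind_sgn T (A : {set T}) : 'CF([set: {perm T}]) :=
  ('Ind[[set: {perm T}]] (sgn_on A))%R.

Lemma ind_sgn_char T (A : {set T}) : ind_sgn A \is a character.
Proof. exact/cfInd_char/cfRepr_char. Qed.

(** Conjugating the argument of [sgn_on A] moves the set [A] instead, so the sum over the group that
    defines induction becomes a sum over the orbit of [A]. *)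
Lemma ind_sgnE T (A : {set T}) (s : {perm T}) :
  ind_sgn A s = (\sum_(C in orbit 'P^* [set: {perm T}] A) sgn_on C s)%R.
Proof.
rewrite cfIndE ?subsetT // (reindex_inj invg_inj) /=.
under eq_bigr => t _ do rewrite sgn_onJ invgK.
under eq_bigl => t do rewrite inE -(in_setT t).
rewrite (sum_act_orbit 'P^*%act _ A (fun C => sgn_on C s)).
by rewrite setTI astab1_set mulKf // neq0CG.
Qed.

(** On the joint stabiliser the product of the two signs is a linear character, whose sum vanishes
    unless it is trivial. If both differences have at most one point, both signs are the sign on
    [A :&: C]. Otherwise a transposition of two points in one difference changes exactly one of
    them. *)
Lemma sum_sgn_on_mul T (A C : {set T}) :
  (\sum_(s in 'N(A | 'P)) sgn_on A s * sgn_on C s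
   = #|'N(A | 'P) :&: 'N(C | 'P)|%:R
     *+ ((#|A :\: C| <= 1) && (#|C :\: A| <= 1))%N)%R.
Proof.
rewrite (bigID (mem 'N(C | 'P))) /= [X in (_ + X)%R]big1 ?addr0; last first.
  by move=> s /andP[_ sC']; rewrite (cfun0 _ sC') mulr0.
under eq_bigl do rewrite -in_setI.
(* A transposition of two points of [B] is odd on [B]; one of two points outside [B] is trivial on
   [B]. *)
have fixes (B : {set T}) a b : a \in B -> b \in B -> tperm a b \in 'N(B | 'P).
  move=> Ba Bb; apply/perm_astabsP => x.
  by case: tpermP => // ->; rewrite ?Ba ?Bb.
have fixesC (B : {set T}) a b : a \notin B -> b \notin B ->
    tperm a b \in 'C(B | 'P).
  move=> B'a B'b; apply/astabP => x Bx; rewrite /= /aperm.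
  by rewrite tpermD //; apply: contraTneq Bx => <-.
have fixesNC (B : {set T}) a b : a \notin B -> b \notin B ->
    tperm a b \in 'N(B | 'P).
  by move=> B'a B'b; apply: (subsetP (astab_sub _ _)); rewrite fixesC.
have odd_restr (B : {set T}) a b : a \in B -> b \in B -> a != b ->
    odd_perm (restr_perm B (tperm a b)).
  move=> Ba Bb neq_ab; suff -> : restr_perm B (tperm a b) = tperm a b.
    by rewrite odd_tperm.
  apply/permP => x; have [Bx | B'x] := boolP (x \in B).
    by rewrite restr_permE ?fixes.
  rewrite (out_perm (restr_perm_on _ _)) // tpermD //;
    by apply: contraNneq B'x => <-.
have even_restr (B : {set T}) a b : a \notin B -> b \notin B ->
    odd_perm (restr_perm B (tperm a b)) = false.
  move=> B'a B'b; suff -> : restr_perm B (tperm a b) = 1 by rewrite odd_perm1.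
  by have := fixesC _ _ _ B'a B'b; rewrite -ker_restr_perm => /mker.
set H := 'N(A | 'P) :&: 'N(C | 'P).
(* Translation by such a [t] permutes the joint stabiliser and negates the sum. *)
have flip t : t \in H -> restr_perm A t (+) restr_perm C t ->
    (\sum_(s in H) sgn_on A s * sgn_on C s = 0 :> algC)%R.
  move=> Ht odd_t; set S := (\sum_(s in H) _)%R.
  have /setIP[tA tC] := Ht.
  suff SN : (S = - S)%R.
    have /eqP : (S *+ 2 = 0)%R by rewrite mulr2n {1}SN addNr.
    by rewrite mulrn_eq0 => /eqP.
  rewrite {1}/S (reindex_inj (mulIg t)) -sumrN /=.
  apply: eq_big => [s|s]; first by rewrite groupMr.
  rewrite groupMr // => /setIP[sA sC].
  rewrite !sgn_onM // mulrACA -mulrN1; congr (_ * _)%R.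
  rewrite !sgn_onE //; move: odd_t.
  by do 2!case: odd_perm; rewrite // ?mulr1 ?mul1r.
have [/andP[lAC lCA] | ] := boolP (_ && _)%N.
  rewrite mulr1n -sumr_const. apply: eq_bigr => s /setIP[sA sC].
  rewrite !sgn_onE // (restr_permI sA sC) // (restr_permI sC sA) // setIC.
  by rewrite -expr2 sqrr_sign.
rewrite mulr0n negb_and -!ltnNge => /orP[] /card_gt1P[a [b [+ + neq_ab]]];
  rewrite !inE => /andP[x'a xa] /andP[x'b xb]; apply: (flip (tperm a b)).
- by rewrite inE fixes ?fixesNC.
- by rewrite odd_restr ?even_restr.
- by rewrite inE fixesNC ?fixes.
- by rewrite even_restr ?odd_restr.
Qed.

Definition close T (A C : {set T}) := ((#|A :\: C| <= 1) && (#|C :\: A| <= 1))%N.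

Definition orbit_weight T (A C : {set T}) : algC :=
  (#|'N(A | 'P) :&: 'N(C | 'P)|%:R / #|'N(A | 'P)|%:R)%R.

(* Mackey's formula: a subset C is counted with the inverse of the length of
   its orbit under the stabiliser of A. *)
Lemma cfdot_ind_sgn T (A B : {set T}) :
  ('[ind_sgn A, ind_sgn B]
   = \sum_(C in orbit 'P^* [set: {perm T}] B | close A C) orbit_weight A C)%R.
Proof.
rewrite -cfdot_Res_r cfdotE big_mkcondr /= mulrC.
under eq_bigr => s sA.
  rewrite cfResE ?subsetT // ind_sgnE rmorph_sum mulr_sumr /=.
  under eq_bigr do rewrite conj_sgn_on.
  over.
rewrite exchange_big mulr_suml; apply: eq_bigr => C _.
rewrite sum_sgn_on_mul /orbit_weight -/(close A C).
by case: close; rewrite ?mulr1n ?mulr0n ?mul0r.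
Qed.

(** Colour each point by its membership in [A] and in [C], or in [A] and in [D]. The hypotheses make
    the two colourings use each colour equally often, so some permutation matches them. *)
Lemma setact_transversal n (A C D : {set 'I_n}) :
    #|C :&: A| = #|D :&: A| -> #|C :\: A| = #|D :\: A| ->
  exists2 s, s \in 'N(A | 'P) & 'P^*%act C s = D.
Proof.
move=> eqI eqD; pose f (B : {set 'I_n}) i := (i \in A, i \in B).
have card_f c (B : {set 'I_n}) :
    count_mem c (map (f B) (enum 'I_n)) = #|[set i | f B i == c]|.
  rewrite count_map -sum1_count big_enum_cond -sum1_card.
  by apply: eq_bigl => i; rewrite inE.
have : perm_eq (map (f C) (enum 'I_n)) [tuple f D i | i < n].
  apply/allP => -[x y] _ /=; apply/eqP; rewrite !card_f.
  have f_tt B : [set i | f B i == (true, true)] = B :&: A.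
    by apply/setP=> i; rewrite !inE xpair_eqE !eqb_id andbC.
  have f_ft B : [set i | f B i == (false, true)] = B :\: A.
    by apply/setP=> i; rewrite !inE xpair_eqE eqb_id eqbF_neg.
  have f_tf B : [set i | f B i == (true, false)] = A :\: (B :&: A).
    apply/setP=> i; rewrite !inE xpair_eqE eqb_id eqbF_neg.
    by case: (i \in A); rewrite ?andbF ?andbT.
  have f_ff B : [set i | f B i == (false, false)] = ~: A :\: (B :\: A).
    apply/setP=> i; rewrite !inE xpair_eqE !eqbF_neg.
    by case: (i \in A); rewrite ?andbF ?andbT.
  have card_tf B : #|A :\: (B :&: A)| = (#|A| - #|B :&: A|)%N.
    by rewrite cardsD setIA (setIC A B) -setIA setIid.
  have card_ff B : #|~: A :\: (B :\: A)| = (#|~: A| - #|B :\: A|)%N.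
    by rewrite cardsD setDE setICA setIid.
  by case: x y => -[]; rewrite ?f_tt ?f_ft ?f_tf ?f_ff ?card_tf ?card_ff ?eqI ?eqD.
case/tuple_permP => p eq_p.
have {}eq_p i : f C i = f D (p i).
  have : nth (f C i) (map (f C) (enum 'I_n)) i = f C i.
    by rewrite (nth_map i) ?size_enum_ord // nth_ord_enum.
  by rewrite eq_p -tnth_nth !tnth_mktuple => <-.
exists p; first by apply/perm_astabsP => x; case: (eq_p x) => ->.
apply/setP => x; rewrite mem_setact_perm; case: (eq_p (p^-1 x)) => _ ->.
by rewrite permKV.
Qed.
Lemma orbit_subset_card n (B C : {set 'I_n}) :
  (C \in orbit 'P^* [set: {perm 'I_n}] B) = (#|C| == #|B|).
Proof.
apply/idP/eqP => [/orbitP[s _ <-] | eqCB]; first exact: card_setact.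
have [||s _ <-] := @setact_transversal n set0 B C; last exact/mem_orbit/in_setT.
  by rewrite !setI0.
by rewrite !setD0.
Qed.

(** The sets [D] form a single orbit under the stabiliser of [A], each weighted by the inverse of
    its length. Hence [cfdot_ind_sgn] counts the orbits of sets close to [A]. *)
Lemma sum_orbit_weight n (A C : {set 'I_n}) :
  (\sum_(D : {set 'I_n} | (#|D :&: A| == #|C :&: A|) && (#|D :\: A| == #|C :\: A|))
     orbit_weight A D = 1)%R.
Proof.
have memO D : (D \in orbit 'P^* 'N(A | 'P) C)
            = ((#|D :&: A| == #|C :&: A|) && (#|D :\: A| == #|C :\: A|))%N.
  apply/orbitP/andP => [[s sA <-] | [/eqP eqI /eqP eqD]]; last first.
    by have [s sA <-] := setact_transversal (esym eqI) (esym eqD); exists s.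
  have memA x : (s^-1 x \in A) = (x \in A) by exact/perm_astabsP/groupVr.
  rewrite -[#|C :&: A|](card_setact 'P _ s) -[#|C :\: A|](card_setact 'P _ s).
  by split; apply/eqP/eq_card => x; rewrite !(inE, mem_setact_perm) memA.
under eq_bigl do rewrite -memO.
rewrite (eq_bigr (fun _ => #|orbit 'P^* 'N(A | 'P) C|%:R^-1)%R) => [|D DC].
  rewrite sumr_const -[LHS]mulr_natr mulVf // pnatr_eq0 -lt0n.
  by apply/card_gt0P; exists C; apply: orbit_refl.
rewrite -(orbit_eqP DC) card_orbit astab1_set /orbit_weight.
rewrite -(LagrangeI 'N(A | 'P) 'N(D | 'P)) -indexgI natrM.
rewrite invfM mulrA divff ?mul1r //.
by rewrite neq0CG.
Qed.

Lemma exists_notin n (A : {set 'I_n}) : (#|A| < n)%N -> exists b, b \notin A.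
Proof.
move=> ltAn; suff /set0Pn[b] : ~: A != set0 by rewrite inE; exists b.
by rewrite -card_gt0 cardsCs setCK card_ord subn_gt0.
Qed.

(** A close set with one more point than [A] must contain [A], so there is one orbit, represented by
    [b |: A]. *)
Lemma cfdot_ind_sgn_succ n (A B : {set 'I_n}) :
  #|B| = #|A|.+1 -> ('[ind_sgn A, ind_sgn B] = 1)%R.
Proof.
move=> cardB; rewrite cfdot_ind_sgn.
have [b A'b] : exists b, b \notin A.
  by apply: exists_notin; rewrite -cardB -[leqRHS]card_ord max_card.
rewrite -[RHS](sum_orbit_weight A (b |: A)); apply: eq_bigl => C.
rewrite orbit_subset_card cardB /close.
have -> : (b |: A) :&: A = A by apply/setIidPr/subsetUr.
have -> : (b |: A) :\: A = [set b].
  by apply/setP=> i; rewrite !inE andb_orr andNb orbF andbC; case: eqP => // ->.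
rewrite cards1 (setIC C).
have := cardsID A C; have := cardsID C A; rewrite (setIC C); lia.
Qed.

(** A set with at least two more points than [A] is never close to it. *)
Lemma cfdot_ind_sgn_far n (A B : {set 'I_n}) :
  (#|A|.+1 < #|B|)%N -> ('[ind_sgn A, ind_sgn B] = 0)%R.
Proof.
move=> ltAB; rewrite cfdot_ind_sgn big_pred0 // => C.
rewrite orbit_subset_card /close.
have := cardsID A C; have := cardsID C A; rewrite (setIC C); lia.
Qed.

Lemma cfnorm_ind_sgn0 n : ('[ind_sgn (set0 : {set 'I_n})] = 1)%R.
Proof.
rewrite cfdot_ind_sgn -[RHS](sum_orbit_weight set0 (set0 : {set 'I_n})).
apply: eq_bigl => C; rewrite orbit_subset_card /close !setI0 !setD0 set0D cards0.
by rewrite eqxx; case: #|C|.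
Qed.

(** The close sets of the same size form two orbits: [A] itself, and the sets got by exchanging one
    point of [A] for an outside point. *)
Lemma cfnorm_ind_sgn n (A : {set 'I_n}) :
  (0 < #|A| < n)%N -> ('[ind_sgn A] = 2%:R)%R.
Proof.
case/andP => /card_gt0P[a Aa] ltAn; rewrite cfdot_ind_sgn.
have [b A'b] : exists b, b \notin A by apply: exists_notin.
(* Representative of the second orbit. *)
pose C0 := b |: (A :\ a).
have C0I : C0 :&: A = A :\ a.
  apply/setP=> i; rewrite !inE; case: eqP => [->|_] /=.
    by rewrite (negPf A'b) andbF.
  by rewrite -andbA andbb.
have C0D : C0 :\: A = [set b].
  apply/setP=> i; rewrite !inE; case: eqP => [->|_] /=; first by rewrite A'b.
  by case: (i \in A); rewrite ?andbF.
rewrite (bigID (fun C => C :\: A == set0)) mulr2n /=; congr (_ + _)%R.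
  rewrite -[RHS](sum_orbit_weight A A); apply: eq_bigl => C.
  rewrite orbit_subset_card /close setIid setDv cards0 -cards_eq0.
  have := cardsID A C; have := cardsID C A; rewrite (setIC C); lia.
rewrite -[RHS](sum_orbit_weight A C0); apply: eq_bigl => C.
rewrite orbit_subset_card /close C0I C0D cards1 -cards_eq0.
have := cardsD1 a A; rewrite Aa.
have := cardsID A C; have := cardsID C A; rewrite (setIC C); lia.
Qed.

End SignedInduction.

(** * Hook characters and n-cycles *)

Section Hooks.
Local Open Scope group_scope.

Definition initial n k : {set 'I_n} := [set i : 'I_n | (i < k)%N].

Lemma card_initial n k : (k <= n)%N -> #|initial n k| = k.
Proof.
move=> le_kn; rewrite -sum1_card; under eq_bigl do rewrite inE.
by rewrite (big_ord_narrow le_kn) sum1_card card_ord.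
Qed.

(* The character of the hook partition (n-k, 1^k), for k < n. *)
Fixpoint hook n k : 'CF([set: {perm 'I_n}]) :=
  (ind_sgn (initial n k) - if k is j.+1 then hook n j else 0)%R.

Lemma initial0 n : initial n 0 = set0.
Proof. by apply/setP => i; rewrite !inE. Qed.

Lemma hookS n k : hook n k.+1 = (ind_sgn (initial n k.+1) - hook n k)%R.
Proof. by []. Qed.

Lemma hook_vchar n k : hook n k \in 'Z[irr [set: {perm 'I_n}]].
Proof.
have psi_vchar j : ind_sgn (initial n j) \in 'Z[irr [set: {perm 'I_n}]].
  exact/char_vchar/ind_sgn_char.
by elim: k => [|k IHk]; rewrite rpredB ?rpred0.
Qed.

(** In the inductive step the value is 2 - 1 for [l = k.+1], 1 - 0 for [l = k.+2], and 0 beyond. *)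
Lemma cfdot_hook_ind n k l : (k <= l < n)%N ->
  ('[hook n k, ind_sgn (initial n l)] = (l <= k.+1)%N%:R)%R.
Proof.
elim: k l => [|k IHk] l /andP[le_kl lt_ln].
  rewrite /= subr0 initial0; case: l le_kl lt_ln => [|[|l]] _ lt_ln.
  - by rewrite initial0 cfnorm_ind_sgn0.
  - by rewrite cfdot_ind_sgn_succ ?cards0 ?card_initial // ltnW.
  - by rewrite cfdot_ind_sgn_far ?cards0 ?card_initial // ltnW.
rewrite hookS cfdotBl IHk; last by rewrite (ltnW le_kl).
have [le_kn le_ln] : (k.+1 <= n)%N /\ (l <= n)%N by lia.
case: (ltngtP l k.+2) => [lt_l|gt_l|eq_l].
- have {lt_l} def_l : l = k.+1 by lia.
  by subst l; rewrite cfnorm_ind_sgn ?card_initial // leqnn -natrB.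
- by rewrite cfdot_ind_sgn_far ?card_initial // leqNgt (ltnW gt_l) subr0.
- subst l; rewrite cfdot_ind_sgn_succ ?card_initial //.
  by rewrite ltnn subr0.
Qed.

Lemma cfdot_hook_le n k l :
  (k <= l < n)%N -> ('[hook n k, hook n l] = (k == l)%:R)%R.
Proof.
elim: k l => [|k IHk].
  elim=> [|l IHl] /andP[_ lt_ln].
    by rewrite /= !subr0 initial0 cfnorm_ind_sgn0.
  rewrite [hook n l.+1]hookS cfdotBr cfdot_hook_ind // IHl ?(ltnW lt_ln) //.
  by case: l {IHl lt_ln} => [|l]; rewrite subrr.
elim=> [|l IHl] // /andP[le_kl lt_ln].
rewrite [hook n l.+1]hookS cfdotBr cfdot_hook_ind ?le_kl //.
move: le_kl; rewrite ltnS leq_eqVlt => /orP[/eqP eq_kl | lt_kl].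
  (* Here the second index has dropped below the first, so symmetry and the outer induction
     hypothesis apply. *)
  subst l; rewrite cfdotC IHk ?leqnSn // (ltn_eqF (ltnSn k)) conjC0 subr0.
  by rewrite eqxx.
rewrite IHl ?lt_kl ?(ltnW lt_ln) // eqSS (ltn_eqF lt_kl).
suff -> : (l.+1 <= k.+2)%N = (k.+1 == l) by rewrite subrr.
by rewrite ltnS eqn_leq lt_kl.
Qed.

Lemma cfdot_hook n k l : (k < n)%N -> (l < n)%N ->
  ('[hook n k, hook n l] = (k == l)%:R)%R.
Proof.
move=> lt_kn lt_ln; have [le_kl | le_lk] := leqP k l.
  by rewrite cfdot_hook_le ?le_kl.
by rewrite cfdotC cfdot_hook_le ?(ltnW le_lk) // eq_sym conjC_nat.
Qed.

Lemma ind_sgn1 n k : (k <= n)%N -> ind_sgn (initial n k) 1 = 'C(n, k)%:R%R.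
Proof.
move=> le_kn; rewrite ind_sgnE (eq_bigr (fun _ => 1%R)) => [|C _]; last first.
  by rewrite sgn_onE ?group1 // morph1 odd_perm1.
under eq_bigl do rewrite orbit_subset_card card_initial //.
by rewrite sumr_const -cardsE card_draws card_ord.
Qed.

(** Pascal's rule collapses the alternating sum of binomials. *)
Lemma hook1 n k : (k < n)%N -> hook n k 1 = 'C(n.-1, k)%:R%R.
Proof.
case: n => // n; elim: k => [|k IHk] lt_kn.
  by rewrite /= subr0 ind_sgn1 // !bin0.
rewrite hookS !cfunE IHk ?(ltnW lt_kn) // ind_sgn1 ?(ltnW lt_kn) //.
by rewrite binS natrD addrK.
Qed.

(** A virtual character of norm 1 is an irreducible character up to sign, and the positive degree
    excludes the minus sign. *)
Lemma hook_irr n k : (k < n)%N -> hook n k \in irr [set: {perm 'I_n}].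
Proof.
move=> lt_kn.
have [|[] [i def_chi]] := vchar_norm1P (hook_vchar n k).
- by rewrite cfdot_hook // eqxx.
- have := hook1 lt_kn; rewrite def_chi cfunE expr1 mulN1r => /eqP.
  have := irr1_gt0 i; rewrite -oppr_lt0 => /[swap]/eqP->.
  by rewrite ltrn0.
- by rewrite def_chi expr0 scale1r mem_irr.
Qed.

Lemma ncyclesP n (s : {perm 'I_n}) :
  reflect (exists x, forall y, y \in porbit s x) (s \in ncycles n).
Proof.
rewrite inE; apply: (iffP existsP) => -[x xP]; exists x.
  by move=> y; rewrite (eqP xP) inE.
by apply/eqP/setP => y; rewrite xP inE.
Qed.

Lemma ncycleV n (s : {perm 'I_n}) : (s^-1 \in ncycles n) = (s \in ncycles n).
Proof. by rewrite !inE; apply: eq_existsb => x; rewrite porbitV. Qed.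

Lemma ncycle_stable n (s : {perm 'I_n}) (C : {set 'I_n}) :
  s \in ncycles n -> s \in 'N(C | 'P) -> C != set0 -> C = setT.
Proof.
case/ncyclesP => x sx sC /set0Pn[y Cy]; apply/setP => z; rewrite inE.
have : z \in porbit s y.
  by rewrite -eq_porbit_mem (eqP (_ : porbit s y == porbit s x)) ?eq_porbit_mem.
case/porbitP => i ->.
by rewrite (perm_astabsP _ _ (groupX i sC)).
Qed.

Lemma hook_ncycle n k (s : {perm 'I_n}) :
  (k < n)%N -> s \in ncycles n -> hook n k s = ((-1) ^+ k)%R.
Proof.
move=> lt_kn ns; elim: k lt_kn => [|k IHk] lt_kn.
  rewrite /= subr0 initial0 ind_sgnE (big_pred1 set0) => [|C]; last first.
    by rewrite orbit_subset_card cards0 cards_eq0.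
  have s0 : s \in 'N(set0 | 'P) by apply/perm_astabsP => x; rewrite !inE.
  rewrite sgn_onE // (_ : restr_perm _ s = 1) ?odd_perm1 //.
  by apply/permP => x; rewrite (out_perm (restr_perm_on _ _)) ?inE // perm1.
rewrite hookS !cfunE IHk ?(ltnW lt_kn) // exprS mulN1r ind_sgnE big1 ?add0r // => C.
rewrite orbit_subset_card card_initial ?(ltnW lt_kn) // => /eqP cardC.
apply: cfun0; apply: contraTN lt_kn => sC.
by rewrite -cardC (ncycle_stable ns sC) ?cardsT ?card_ord ?ltnn // -card_gt0 cardC.
Qed.

Lemma ncycleJ n (s t : {perm 'I_n}) : (s ^ t \in ncycles n) = (s \in ncycles n).
Proof.
wlog suff: s t / s \in ncycles n -> s ^ t \in ncycles n.
  move=> IH; apply/idP/idP => [/(IH _ t^-1)|/IH->//]; by rewrite conjgK.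
case/ncyclesP => x sx; apply/ncyclesP; exists (t x) => y.
have /porbitP[i def_y] := sx (t^-1 y); apply/porbitP; exists i.
by rewrite -conjXg permJ -def_y permKV.
Qed.

(** Every point is a power of [s] applied to [x], so a permutation commuting with [s] is determined
    by its value at [x]. *)
Lemma cent_ncycle_inj n (s : {perm 'I_n}) x :
    (forall y, y \in porbit s x) ->
  {in 'C[s] &, injective (fun t : {perm 'I_n} => t x)}.
Proof.
move=> sx t u /cent1P cst /cent1P csu eq_tu; apply/permP => y.
have /porbitP[i ->] := sx y.
by rewrite -!permM -(commuteX i cst) -(commuteX i csu) !permM eq_tu.
Qed.

(** The reverse inequality comes from the character sum in [irr_ncycle_support]. *)
Lemma card_cent_ncycle n (s : {perm 'I_n}) :
  s \in ncycles n -> (#|'C[s]| <= n)%N.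
Proof.
case/ncyclesP => x /cent_ncycle_inj inj_x; rewrite -[leqRHS]card_ord.
by rewrite -(card_in_imset inj_x) max_card.
Qed.

Lemma order_ncycle n (s : {perm 'I_n}) : s \in ncycles n -> #[s] = n.
Proof.
case/ncyclesP => x sx; rewrite -[RHS]card_ord -cardsT.
have -> : [set: 'I_n] = [set (t : {perm 'I_n}) x | t in <[s]>].
  apply/esym/setP => y; rewrite inE; have /porbitP[i ->] := sx y.
  by apply/imset_f/mem_cycle.
have sub_sC : <[s]> \subset 'C[s] by rewrite cycle_subG cent1id.
by rewrite card_in_imset //; apply/(sub_in2 (subsetP sub_sC))/cent_ncycle_inj.
Qed.

(** The conjugating permutation sends [(s ^+ i) x] to [(t ^+ i) y]; on both sides the exponent
    matters exactly modulo [n]. *)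
Lemma ncycle_conj n (s t : {perm 'I_n}) :
  s \in ncycles n -> t \in ncycles n -> t \in s ^: [set: {perm 'I_n}].
Proof.
move=> ns nt; have [x sx] := ncyclesP _ ns; have [y ty] := ncyclesP _ nt.
have eq_pow (r : {perm 'I_n}) z i j : r \in ncycles n ->
    (forall z', z' \in porbit r z) ->
    ((r ^+ i) z == (r ^+ j) z) = (i == j %[mod n]).
  move=> nr rz.
  have -> : (i == j %[mod n]) = (r ^+ i == r ^+ j).
    by rewrite eq_expg_mod_order order_ncycle.
  apply/eqP/eqP => [|->//]; apply: (cent_ncycle_inj rz);
    exact/cent1P/commute_sym/commuteX/commute_refl.
have ex_log z : exists i, z == (s ^+ i) x.
  by have /porbitP[i ->] := sx z; exists i.
pose log z := xchoose (ex_log z).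
have logK z : (s ^+ log z) x = z by apply/esym/eqP/(xchooseP (ex_log z)).
have inj_u : injective (fun z => (t ^+ log z) y).
  move=> z z' /eqP; rewrite eq_pow // => eq_zz'; apply/eqP.
  by rewrite -(logK z) -(logK z') eq_pow.
apply/imsetP; exists (perm inj_u); first by rewrite inE.
apply/permP => z; rewrite -[z](permKV (perm inj_u)) permJ.
(* What remains is that the logarithm of [s z] is one more than that of [z] modulo [n]. *)
move: (_ z) => {}z; rewrite !permE -permM -expgSr; apply/eqP.
by rewrite eq_pow // -(eq_pow s x) // logK expgSr permM logK.
Qed.

Lemma exists_ncycle n : exists s : {perm 'I_n.+1}, s \in ncycles n.+1.
Proof.
pose s := perm (can_inj (@ordSK n.+1)); exists s.
apply/ncyclesP; exists ord0 => y; apply/porbitP; exists y.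
suff val_s i : val ((s ^+ i) ord0) = (i %% n.+1)%N.
  by apply: val_inj; rewrite val_s modn_small.
elim: i => [|i IHi]; first by rewrite expg0 perm1 mod0n.
by rewrite expgSr permM permE /= [X in (X.+1)]IHi -addn1 modnDml addn1.
Qed.

End Hooks.

(** On column vectors this is left multiplication by the central idempotent of ['chi_i] in the group
    algebra. *)
Definition irr_mx (gT : finGroupType) (i : Iirr [set: gT]) : 'M[algC]_#|gT| :=
  \matrix_(u, v) ('chi_i 1%g / #|gT|%:R * 'chi_i (enum_val v * (enum_val u)^-1)%g).

(** * Spectrum of a normal Cayley graph *)

Lemma card_gT_neq0 (gT : finGroupType) : #|gT|%:R != 0 :> algC.
Proof. by rewrite -cardsT neq0CG. Qed.

Lemma irr_mxM (gT : finGroupType) (i j : Iirr [set: gT]) :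
  irr_mx i *m irr_mx j = irr_mx i *+ (i == j).
Proof.
apply/matrixP => u w; rewrite mulrb !mxE.
pose a := enum_val u; pose b := enum_val w.
pose F v := 'chi_i (v * a^-1)%g * 'chi_j (b * v^-1)%g.
pose d := 'chi_i 1%g / #|gT|%:R * ('chi_j 1%g / #|gT|%:R).
rewrite (eq_bigr (fun v => d * F (enum_val v))) => [|v _]; last first.
  by rewrite !mxE mulrACA.
rewrite -mulr_sumr -(big_enum_val F) (reindex_inj (mulIg b)) /=.
(* After the shift by [b] the sum is the convolution of two irreducible characters at [b * a^-1]. *)
have -> : \sum_(x : gT) F (x * b)%g
        = #|gT|%:R * ((i == j)%:R * ('chi_i (b * a^-1)%g / 'chi_i 1%g)).
  rewrite -generalized_orthogonality_relation cardsT mulVKf ?card_gT_neq0 //.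
  apply: eq_big => [x|x _]; first by rewrite inE.
  by rewrite /F invMg mulKVg -mulgA.
rewrite /d; have [<- | neq_ij] := eqVneq i j; last by rewrite mul0r !mulr0 mxE.
have := irr1_neq0 i; rewrite mul1r !mxE => d_neq0; field.
by rewrite card_gT_neq0 d_neq0.
Qed.

(** The trace of an idempotent is its rank, here the multiplicity of the eigenvalue attached to
    [i]. *)
Lemma mxtrace_irr_mx (gT : finGroupType) (i : Iirr [set: gT]) :
  \tr (irr_mx i) = 'chi_i 1%g ^+ 2.
Proof.
rewrite /mxtrace (eq_bigr (fun _ => 'chi_i 1%g / #|gT|%:R * 'chi_i 1%g)) => [|u _].
  by rewrite sumr_const card_ord -[LHS]mulr_natr mulrAC divfK ?card_gT_neq0.
by rewrite mxE mulgV.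
Qed.

(** Orthogonality of the idempotents removes the cross terms. Exponent zero would instead say that
    the idempotents sum to the identity. *)
Lemma sum_irr_mx_exp (gT : finGroupType) (l : Iirr [set: gT] -> algC) m :
  (\sum_i l i *: irr_mx i) ^+ m.+1 = \sum_i l i ^+ m.+1 *: irr_mx i.
Proof.
elim: m => [|m IHm]; first by under [RHS]eq_bigr do rewrite expr1.
rewrite exprSr IHm -[LHS]/(_ *m _) mulmx_suml; apply: eq_bigr => i _.
rewrite mulmx_sumr (bigD1 i) //= big1 => [|j neq_ji].
  by rewrite addr0 -scalemxAl -scalemxAr irr_mxM eqxx mulr1n scalerA -exprSr.
by rewrite -scalemxAl -scalemxAr irr_mxM eq_sym (negPf neq_ji) mulr0n !scaler0.
Qed.

Lemma cayley_adj_normal (gT : finGroupType) (S : {set gT}) :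
  (forall x, (x^-1%g \in S) = (x \in S)) -> cayley_adj S \is normalmx.
Proof.
move=> symS; apply: symmetric_normalmx.
  rewrite is_hermitianmxE; apply/eqP/matrixP => u v.
  by rewrite !mxE expr0 mul1r -symS invMg invgK.
by apply/mxOverP => u v; rewrite mxE realn.
Qed.

Definition irr_dim (gT : finGroupType) (i : Iirr [set: gT]) :=
  irr_degree (socle_of_Iirr i).

(** Expanding the indicator of [S] in irreducible characters writes the adjacency matrix as a
    combination of orthogonal idempotents. Comparing traces of powers then replaces the construction
    of an eigenbasis. *)
Lemma spectrum_cayley (gT : finGroupType) (S : {set gT})
    (c : Iirr [set: gT] -> algC) :
    (forall x, (x^-1%g \in S) = (x \in S)) ->
    (forall x, (x \in S)%:R = \sum_i c i * 'chi_i x) ->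
  perm_eq (spectrum (cayley_adj S))
          (flatten [seq nseq (irr_dim i ^ 2) (c i * #|gT|%:R / 'chi_i 1%g)
                   | i <- enum (Iirr [set: gT])]).
Proof.
move=> symS defS; pose l i := c i * #|gT|%:R / 'chi_i 1%g.
have defA : cayley_adj S = \sum_i l i *: irr_mx i.
  apply/matrixP => u v; rewrite mxE defS summxE; apply: eq_bigr => i _.
  rewrite !mxE mulrA; congr (_ * _); rewrite /l.
  by have := irr1_neq0 i; move=> d_neq0; field; rewrite card_gT_neq0.
apply: perm_eq_power_sums => m; rewrite spectrum_power_sum ?cayley_adj_normal //.
rewrite big_flatten big_map big_enum /=.
have -> : \tr (cayley_adj S ^+ m) = \sum_i 'chi_i 1%g ^+ 2 * l i ^+ m.
  (* For exponent zero the claim is that the squared degrees sum to the group order. *)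
  case: m => [|m].
    rewrite expr0; under [RHS]eq_bigr do rewrite expr0 mulr1.
    by rewrite irr_sum_square cardsT mxtrace1.
  rewrite defA sum_irr_mx_exp linear_sum; apply: eq_bigr => i _ /=.
  by rewrite mxtraceZ mxtrace_irr_mx mulrC.
apply: eq_bigr => i _; rewrite big_nseq iter_addr_0 -[RHS]mulr_natl natrX.
by rewrite /irr_dim -irr1_degree.
Qed.

(** * Irreducible characters at n-cycles and the resulting spectrum *)

Definition hook_idx n (k : 'I_n) : Iirr [set: {perm 'I_n}] := cfIirr (hook n k).

Lemma hook_idxE n (k : 'I_n) : 'chi_(hook_idx k) = hook n k.
Proof. exact/cfIirrE/hook_irr. Qed.

Lemma hook_idx_inj n : injective (@hook_idx n).
Proof.
move=> k l eq_kl; apply/val_inj/eqP; rewrite -[_ == _]lt0b -(ltr0n algC).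
rewrite -(cfdot_hook (ltn_ord k) (ltn_ord l)) -!hook_idxE eq_kl cfdot_irr eqxx.
exact: ltr01.
Qed.

Lemma sum_hook_idx n (V : nmodType) (F : Iirr [set: {perm 'I_n}] -> V) :
    (forall i, i \notin codom (@hook_idx n) -> F i = 0) ->
  \sum_i F i = \sum_k F (hook_idx k).
Proof.
move=> F0; rewrite (bigID [in codom (@hook_idx n)]) /= [X in _ + X]big1 ?addr0 //.
rewrite -big_uniq ?big_map ?big_enum //.
by rewrite map_inj_uniq ?enum_uniq //; apply: hook_idx_inj.
Qed.

(** The squared moduli of the character values at [s] sum to the order of its centraliser, at most
    [n], while the hooks alone contribute [n]. Both conclusions follow at once. *)
Lemma irr_ncycle_support n (s : {perm 'I_n}) : s \in ncycles n ->
  (forall i, i \notin codom (@hook_idx n) -> 'chi[[set: {perm 'I_n}]]_i s = 0)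
  /\ #|'C[s]%g| = n.
Proof.
move=> ns; pose nz i := `|'chi[[set: {perm 'I_n}]]_i s| ^+ 2.
have sum_nz : \sum_i nz i = #|'C[s]%g|%:R.
  have := second_orthogonality_relation s (in_setT s).
  rewrite class_refl mulr1n setTI => <-.
  by apply: eq_bigr => i _; rewrite /nz normCK.
have nz_hook (k : 'I_n) : nz (hook_idx k) = 1.
  by rewrite /nz hook_idxE hook_ncycle // normrX normrN1 !expr1n.
rewrite (bigID [in codom (@hook_idx n)]) /= in sum_nz.
have sum_hook : \sum_(i in codom (@hook_idx n)) nz i = n%:R.
  rewrite big_mkcond sum_hook_idx => [|i /negPf-> //].
  under eq_bigr do rewrite codom_f nz_hook.
  by rewrite sumr_const card_ord.
have rest_ge0 i : i \notin codom (@hook_idx n) -> 0 <= nz i.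
  by move=> _; rewrite exprn_ge0.
have rest0 : \sum_(i | i \notin codom (@hook_idx n)) nz i = 0.
  apply/eqP; rewrite eq_le sumr_ge0 // andbT -(lerD2l n%:R) addr0.
  by rewrite -{1}sum_hook sum_nz ler_nat card_cent_ncycle.
split=> [i|].
  by move/(psumr_eq0P rest_ge0 rest0)/eqP; rewrite sqrf_eq0 normr_eq0 => /eqP.
by apply/eqP; rewrite -(eqr_nat algC) -sum_nz rest0 addr0 sum_hook.
Qed.

(** As the n-cycles form one conjugacy class, column orthogonality gives the expansion of their
    indicator in irreducible characters. *)
Lemma sum_irr_ncycle n (s t : {perm 'I_n}) : s \in ncycles n ->
  \sum_i ('chi[[set: {perm 'I_n}]]_i s)^* * 'chi_i t = n%:R *+ (t \in ncycles n).
Proof.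
move=> ns; under eq_bigr do rewrite mulrC.
rewrite second_orthogonality_relation ?in_setT //.
have -> : (t \in s ^: [set: {perm 'I_n}]%G)%g = (t \in ncycles n).
  by apply/idP/idP => [/imsetP[u _ ->]|]; [rewrite ncycleJ | apply: ncycle_conj].
have [nt|] := boolP (t \in ncycles n); rewrite ?mulr0n // setTI.
by congr (_%:R *+ _); apply: (irr_ncycle_support nt).2.
Qed.

(** The factorials are the quotient of (n-1)! by the hook degree C(n-1,k). *)
Definition hook_eigenvalue n k : algC := (-1) ^+ k * (k`! * (n.-1 - k)`!)%N%:R.

(** As [g] vanishes at 0, only hooks contribute. Taking for [g] the absolute value or an indicator
    yields energy, integrality and the count of nonzero eigenvalues. *)
Lemma big_spectrum_ncycles n (V : nmodType) (g : algC -> V) :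
    (0 < n)%N -> g 0 = 0 ->
  \sum_(x <- spectrum (cayley_adj (ncycles n))) g x
    = \sum_(k < n) g (hook_eigenvalue n k) *+ 'C(n.-1, k) ^ 2.
Proof.
case: n => // n _ g0; have [s ns] := exists_ncycle n.
pose c i := ('chi[[set: {perm 'I_n.+1}]]_i s)^* / n.+1%:R.
have defZ t : (t \in ncycles n.+1)%:R = \sum_i c i * 'chi_i t.
  under eq_bigr do rewrite mulrAC.
  rewrite -mulr_suml (sum_irr_ncycle t ns) .
  by case: (t \in _); rewrite ?mulr1n ?mulr0n ?mul0r // divff // pnatr_eq0.
rewrite (perm_big _ (spectrum_cayley (@ncycleV n.+1) defZ)).
rewrite big_flatten big_map big_enum /=.
under eq_bigr do rewrite big_nseq iter_addr_0.
rewrite sum_hook_idx => [|i /(irr_ncycle_support ns).1 chi0]; last first.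
  by rewrite /c chi0 conjC0 !mul0r g0 mul0rn.
apply: eq_bigr => k _.
have chi1 : 'chi_(hook_idx k) 1%g = 'C(n, k)%:R by rewrite hook_idxE hook1.
have -> : irr_dim (hook_idx k) = 'C(n, k).
  by apply/eqP; rewrite -(eqr_nat algC) -irr1_degree chi1.
congr (g _ *+ _); rewrite /c chi1 hook_idxE hook_ncycle // rmorph_sign card_Sn.
rewrite -!mulrA; congr (_ * _).
have le_kn : (k <= n)%N by rewrite -ltnS.
rewrite factS -(bin_fact le_kn) !natrM.
have C0 : 'C(n, k)%:R != 0 :> algC by rewrite pnatr_eq0 -lt0n bin_gt0.
have n0 : 1 + n%:R != 0 :> algC by rewrite nat1r pnatr_eq0.
by field; rewrite C0 n0.
Qed.

(** * Binomial sums, energy and nullity *)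

Lemma sum_bin n : (\sum_(k < n.+1) 'C(n, k) = 2 ^ n)%N.
Proof. by rewrite (expnDn 1 1); apply: eq_bigr => k _; rewrite !exp1n !muln1. Qed.

Lemma sum_bin_sqr n : (\sum_(k < n.+1) 'C(n, k) ^ 2 = 'C(2 * n, n))%N.
Proof.
rewrite mul2n -addnn -binomial.Vandermonde; apply: eq_bigr => k _.
by rewrite bin_sub // -ltnS.
Qed.

Lemma size_spectrum_ncycles n : size (spectrum (cayley_adj (ncycles n))) = n`!.
Proof.
have := spectrum_power_sum 0 (cayley_adj_normal (@ncycleV n)).
rewrite expr0 mxtrace1; under eq_bigr do rewrite expr0.
rewrite big_const_seq count_predT iter_addr_0 => /eqP.
by rewrite eqr_nat => /eqP->; apply: card_Sn.
Qed.

(** One binomial factor of the multiplicity turns k!(n-1-k)! into (n-1)!; the other is summed over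
    k. *)
Lemma energy_ncycles n : (0 < n)%N ->
  energy (cayley_adj (ncycles n)) = (2 ^ n.-1 * n.-1`!)%N%:R.
Proof.
case: n => // n _; rewrite /energy big_spectrum_ncycles ?normr0 //=.
rewrite -sum_bin big_distrl natr_sum; apply: eq_bigr => k _ /=.
have le_kn : (k <= n)%N by rewrite -ltnS.
rewrite normrM normrX normrN1 expr1n mul1r normr_nat -[LHS]mulr_natl -natrM.
by rewrite -(bin_fact le_kn) -mulnn -mulnA.
Qed.

Lemma count_nonzero_ncycles n : (0 < n)%N ->
  count (predC (pred1 0)) (spectrum (cayley_adj (ncycles n))) = 'C(2 * n.-1, n.-1).
Proof.
case: n => // n _; rewrite -sum1_count big_mkcond big_spectrum_ncycles /= ?eqxx //.
rewrite -sum_bin_sqr; apply: eq_bigr => k _.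
by rewrite mulf_neq0 ?signr_eq0 ?natn // pnatr_eq0 -lt0n muln_gt0 !fact_gt0.
Qed.

Theorem theorem1p1 (n : nat) (hn : (4 <= n)%N) :
  let A := cayley_adj (ncycles n) in
  [/\ integral_mx A,
      hyperenergetic A,
      energy A = (2 ^ n.-1 * n.-1`!)%N%:R
    & nullity A = (n`! - 'C(2 * n - 2, n - 1))%N].
Proof.
have n_gt0 : (0 < n)%N by apply: leq_trans hn.
move=> A; have energyA : energy A = _ := energy_ncycles n_gt0; split=> //.
(* Integrality is restated as a zero count of non-integral eigenvalues, so that
   [big_spectrum_ncycles] applies. *)
- rewrite /integral_mx -[all _ _]negbK -has_predC has_count -leqNgt leqn0.
  rewrite -sum1_count big_mkcond /= (big_spectrum_ncycles n_gt0) /= ?rpred0 //.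
  rewrite big1 // => k _.
  suff -> : hook_eigenvalue n k \in Num.int by rewrite mul0rn.
  by rewrite rpredM ?rpredX ?rpredN1 ?rpred_nat.
- rewrite /hyperenergetic energyA card_Sn ltrBlDr -natrM -natrD ltr_nat.
  (* Equality holds at n = 4. Multiplied by (n-1)!, this bounds 2 n! by the energy. *)
  have le_2n : (2 * n <= 2 ^ n.-1)%N.
    elim: n hn {n_gt0 A energyA} => // n IHn.
    rewrite leq_eqVlt => /orP[/eqP <- //|lt3n].
    by have := IHn lt3n; case: n {IHn} lt3n => // n; rewrite /= expnS; lia.
  case: n n_gt0 le_2n {hn A energyA} => // n _ le_2n.
  by rewrite factS mulnA addn2 ltnS leqW // leq_mul2r le_2n orbT.
- rewrite /nullity -size_spectrum_ncycles -(count_predC (pred1 0)).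
  have -> : 'C(2 * n - 2, n - 1) = count (predC (pred1 0)) (spectrum A);
    last by rewrite addnK.
  rewrite count_nonzero_ncycles // subn1; congr 'C(_, _); lia.
Qed.
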